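(* Let $m\ge 2$, let $A_1,\ldots,A_m\in\mathbb{M}_d$ be positive semidefinite, and put $C=\bigvee_{j=1}^m A_j$ (supremum in the spectral order) and $S=\sum_{j=1}^m A_j$. For each fixed real $p$ with $1<p<\infty$, $$\|C\|_p=\|S\|_p\iff A_iA_j=0\ \text{ for all } i\ne j .$$ These conditions are also equivalent to $C=S$.
   Context: $\mathbb{M}_d$ is the algebra of complex $d\times d$ matrices. For $1\le p<\infty$ the Schatten $p$-norm is $\|X\|_p=(\operatorname{Tr}|X|^p)^{1/p}$ with $|X|=(X^*X)^{1/2}$ and $\operatorname{Tr}$ the unnormalized trace. For a Hermitian $X\in\mathbb{M}_d$ and $t\in\mathbb{R}$, $E_X(t)=\mathbf{1}_{(t,\infty)}(X)$ is the orthogonal projection onto the span of the eigenvectors of $X$ with eigenvalue $>t$. The spectral order on Hermitian matrices is: $A\preceq B$ iff $E_A(t)\le E_B(t)$ for all $t\in\mathbb{R}$. With this order the Hermitian matrices in $\mathbb{M}_d$ form a lattice (Olson); $\bigvee_{j=1}^m A_j$ denotes the supremum of the family. It is characterized by the condition that, for every $t\in\mathbb{R}$, $E_{\bigvee_j A_j}(t)$ is the orthogonal projection onto $\operatorname{Ran}E_{A_1}(t)+\cdots+\operatorname{Ran}E_{A_m}(t)$. *)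

(* Defs.v *)
From HB Require Import structures.
From mathcomp Require Import all_boot all_order all_algebra.
From mathcomp Require Import spectral sesquilinear complex.
From mathcomp Require Import all_classical all_reals all_analysis.

Set Implicit Arguments.
Unset Strict Implicit.
Unset Printing Implicit Defensive.

Import Order.TTheory GRing.Theory Num.Theory.

Local Open Scope ring_scope.
Local Open Scope complex_scope.
Local Open Scope sesquilinear_scope.
Local Open Scope classical_set_scope.

Section SpectralOrder.
Context {R : realType} {d : nat}.
Implicit Types (X A B C : 'M[R[i]]_d).

(* On [R[i]], [0 <= z] says that [z] is real and nonnegative. *)
Definition psdmx A : Prop :=
  A \is hermsymmx /\ forall v : 'cV[R[i]]_d, 0 <= (v^t* *m A *m v) 0 0.

Definition loewner_le A B : Prop := psdmx (B - A).

(* Functional calculus f(X), meaningful only for Hermitian X: the eigenvalues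
   are then real, so that [complex.Re] loses nothing, and
   X = P^-1 D P with P unitary and D diagonal. *)
Definition mxfun (f : R -> R) X : 'M[R[i]]_d :=
  invmx (spectralmx X)
    *m diag_mx (map_mx (fun z : R[i] => (f (complex.Re z))%:C)
                       (spectral_diag X))
    *m spectralmx X.

Definition absmx X : 'M[R[i]]_d := mxfun Num.sqrt (X^t* *m X).

(* The trace below is real, since [absmx X] is positive semidefinite. *)
Definition schatten_norm (p : R) X : R :=
  (complex.Re (\tr (mxfun (fun x => x `^ p) (absmx X)))) `^ p^-1.

(* E_X(t) = 1_{(t, +oo)}(X) *)
Definition spectral_proj X (t : R) : 'M[R[i]]_d :=
  mxfun (fun x => (t < x)%R%:R) X.

Definition spectral_le A B : Prop :=
  forall t : R, loewner_le (spectral_proj A t) (spectral_proj B t).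

Definition is_spectral_sup {m : nat} (A : 'I_m -> 'M[R[i]]_d) C : Prop :=
  [/\ C \is hermsymmx,
      forall j, spectral_le (A j) C &
      forall B, B \is hermsymmx -> (forall j, spectral_le (A j) B) ->
        spectral_le C B].

(* For m >= 1 and Hermitian A_j the supremum exists (Olson) and is unique,
   so the default value 0 is not used. *)
Definition spectral_sup {m : nat} (A : 'I_m -> 'M[R[i]]_d) : 'M[R[i]]_d :=
  xget 0 [set C | is_spectral_sup A C].

End SpectralOrder.

(* Main.v *)
Require Import Defs.
From mathcomp Require Import all_boot all_order all_algebra.
From mathcomp Require Import spectral sesquilinear complex ring lra.
From mathcomp Require Import all_classical all_reals all_analysis.

(** The theorem compares three numbers, where the a_jk are the eigenvalues of
    A_j, the c_k those of C and the s_l those of S: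

      sum_k c_k^p  <=  sum_j sum_k a_jk^p  <=  sum_l s_l^p.

    The two outer numbers are the p-th powers of the Schatten norms of C and S.

    The first inequality ([sup_sum_powR_le]) holds because the range of E_C(t)
    lies in the sum of the ranges of the E_(A_j)(t), so that C has at most as
    many eigenvalues above t as all the A_j together ([sup_tr_proj_le]); an
    increasing function of the eigenvalues then has the smaller sum
    ([sum_le_count]).  To see that E_C(t) is so small, C is compared with the
    upper bound equal to a large constant K on the sum of the ranges and to t on
    its orthogonal complement.

    The second inequality is McCarthy's ([mccarthy_le]).  Since S^p is
    sum_j S^(p-1) A_j, it is enough to bound tr (S^(p-1) A) from below by
    tr A^p whenever 0 <= A <= S.  For a unit eigenvector u of A with eigenvalue
    a > 0, let q_l be the squared moduli of the coordinates of u in an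
    eigenbasis of S.  They have sum 1, and A <= S forces
    a * sum_l q_l / s_l <= 1 ([overlap_inv_le]).  The tangent inequality
    s^(p-1) >= p a^(p-1) - (p-1) a^p / s, averaged with the weights q_l, gives
    <u, S^(p-1) u> >= a^(p-1).  That inequality is strict for s <> a, so equality
    makes u an eigenvector of S with eigenvalue a; hence S A_j = A_j^2 for all
    j, the products A_j (sum_(i <> j) A_i) A_j vanish, and by positivity so do
    all the A_i A_j with i <> j ([mccarthy_eq]).

    Conversely, for an orthogonal family E_S(t) = sum_j E_(A_j)(t) when t >= 0,
    and S is the supremum ([sum_ortho_is_sup]); antisymmetry of the spectral
    order makes suprema unique, so C = S.  Finally C = S gives equal norms, which
    closes the circle. *)

Import Order.TTheory GRing.Theory Num.Theory.
Local Open Scope ring_scope.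
Local Open Scope complex_scope.

Local Open Scope sesquilinear_scope.

Set Implicit Arguments.
Unset Strict Implicit.
Unset Printing Implicit Defensive.

(** * Adjoints and squared moduli *)

Section Hermitian.
Context {R : realType}.
Local Notation M n := 'M[R[i]]_n.

Lemma hermE n (X : M n) : (X \is hermsymmx) = (X^t* == X).
Proof. by rewrite is_hermitianmxE expr0 scale1r eq_sym. Qed.

Lemma hermP n (X : M n) : reflect (X^t* = X) (X \is hermsymmx).
Proof. rewrite hermE; exact: eqP. Qed.

Lemma adjM m n q (A : 'M[R[i]]_(m, n)) (B : 'M[R[i]]_(n, q)) :
  (A *m B)^t* = B^t* *m A^t*.
Proof. by rewrite trmx_mul map_mxM. Qed.

Lemma adjD m n (A B : 'M[R[i]]_(m, n)) : (A + B)^t* = A^t* + B^t*.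
Proof. by rewrite linearD map_mxD. Qed.

Lemma adj0 m n : (0 : 'M[R[i]]_(m, n))^t* = 0.
Proof. by rewrite trmx0 map_mx0. Qed.

Lemma adjB m n (A B : 'M[R[i]]_(m, n)) : (A - B)^t* = A^t* - B^t*.
Proof. by rewrite linearB map_mxB. Qed.

Lemma hermD n (A B : M n) :
  A \is hermsymmx -> B \is hermsymmx -> A + B \is hermsymmx.
Proof. by move=> /hermP hA /hermP hB; apply/hermP; rewrite adjD hA hB. Qed.

Lemma hermB n (A B : M n) :
  A \is hermsymmx -> B \is hermsymmx -> A - B \is hermsymmx.
Proof. by move=> /hermP hA /hermP hB; apply/hermP; rewrite adjB hA hB. Qed.

Lemma herm0 n : (0 : M n) \is hermsymmx.
Proof. by apply/hermP; rewrite adj0. Qed.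

Lemma herm_sum n (I : finType) (P : pred I) (A : I -> M n) :
  (forall i, A i \is hermsymmx) -> \sum_(i | P i) A i \is hermsymmx.
Proof. by move=> hA; elim/big_ind: _; [exact: herm0|exact: hermD|]. Qed.

(** Real-valued, so that estimates take place in [R] and not in the partial
    order of [R[i]]. *)
Definition sqmod (z : R[i]) : R := complex.Re z ^+ 2 + complex.Im z ^+ 2.

Lemma sqmodE z : (sqmod z)%:C = Num.conj z * z.
Proof. by rewrite /sqmod add_Re2_Im2 normCKC. Qed.

Lemma sqmod_ge0 z : 0 <= sqmod z.
Proof. by rewrite addr_ge0 ?sqr_ge0. Qed.

Lemma sqmod_eq0 z : (sqmod z == 0) = (z == 0).
Proof.
by rewrite -(inj_eq (@complexI R)) sqmodE /= mulf_eq0 conjC_eq0 orbb.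
Qed.

Lemma sqmodM y z : sqmod (y * z) = sqmod y * sqmod z.
Proof. by apply: complexI; rewrite rmorphM /= !sqmodE rmorphM; ring. Qed.

Lemma sqmodC (z : R[i]) : sqmod (Num.conj z) = sqmod z.
Proof. by apply: complexI; rewrite !sqmodE conjCK mulrC. Qed.

Lemma sqmod_real (x : R) : sqmod x%:C = x ^+ 2.
Proof. by rewrite /sqmod /= expr0n addr0. Qed.

Lemma dot_sqmod n (w : 'cV[R[i]]_n) :
  (w^t* *m w) 0 0 = (\sum_k sqmod (w k 0))%:C.
Proof.
rewrite rmorph_sum mxE; apply: eq_bigr => k _.
by rewrite !mxE; exact/esym/sqmodE.
Qed.

Lemma dot_eq0 n (w : 'cV[R[i]]_n) : (w^t* *m w) 0 0 = 0 -> w = 0.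
Proof.
rewrite dot_sqmod => /complexI /psumr_eq0P H.
apply/colP => k; rewrite mxE; apply/eqP; rewrite -sqmod_eq0.
by apply/eqP/H => // j _; exact: sqmod_ge0.
Qed.

End Hermitian.

(** * Functional calculus in an eigenbasis *)

Section FunctionalCalculus.
Context {R : realType} {d : nat}.
Local Notation M := 'M[R[i]]_d.
Local Notation V := 'cV[R[i]]_d.
Implicit Types (X Y : M) (f g : R -> R) (v : V) (a : R).

Definition eigval X (k : 'I_d) : R := complex.Re (spectral_diag X 0 k).

Definition fdiag f X : M := diag_mx (\row_k (f (eigval X k))%:C).

Lemma mxfunE f X :
  mxfun f X = (spectralmx X)^t* *m fdiag f X *m spectralmx X.
Proof.
rewrite /mxfun (invmx_unitary (spectral_unitarymx X)) /fdiag.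
rewrite (_ : map_mx _ _ = \row_k (f (eigval X k))%:C) //.
by apply/rowP => k; rewrite !mxE.
Qed.

Lemma spectralmxVl X : (spectralmx X)^t* *m spectralmx X = 1%:M.
Proof.
by rewrite -invmx_unitary ?spectral_unitarymx // mulVmx // spectral_unit.
Qed.

Lemma spectralmxVr X : spectralmx X *m (spectralmx X)^t* = 1%:M.
Proof. exact/unitarymxP/spectral_unitarymx. Qed.

Lemma mxfun_ext f g X :
  (forall k, f (eigval X k) = g (eigval X k)) -> mxfun f X = mxfun g X.
Proof.
move=> fg; rewrite !mxfunE (_ : fdiag f X = fdiag g X) // /fdiag.
congr diag_mx; by apply/rowP => k; rewrite !mxE fg.
Qed.

Lemma mxfunM f g X : mxfun f X *m mxfun g X = mxfun (fun x => f x * g x) X.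
Proof.
rewrite !mxfunE -!mulmxA (mulmxA (spectralmx X)) spectralmxVr mul1mx.
rewrite (mulmxA (fdiag f X)).
rewrite (_ : fdiag f X *m _ = fdiag (fun x => f x * g x) X) //.
rewrite mulmx_diag; congr diag_mx.
by apply/rowP => k; rewrite !mxE rmorphM.
Qed.

Lemma mxfunB f g X : mxfun f X - mxfun g X = mxfun (fun x => f x - g x) X.
Proof.
rewrite !mxfunE -mulmxBl -mulmxBr.
rewrite (_ : fdiag f X - fdiag g X = fdiag (fun x => f x - g x) X) //.
rewrite /fdiag -raddfB /=; congr diag_mx.
by apply/rowP => k; rewrite !mxE rmorphB.
Qed.

Lemma mxfun1 X : mxfun (fun=> 1) X = 1%:M.
Proof.
rewrite mxfunE -[RHS](spectralmxVl X); congr (_ *m _).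
rewrite -[RHS]mulmx1; congr (_ *m _); rewrite -diag_const_mx; congr diag_mx.
by apply/rowP => k; rewrite !mxE.
Qed.

Lemma mxfun0 X : mxfun (fun=> 0) X = 0.
Proof. by have := mxfunB (fun=> 0) (fun=> 0) X; rewrite subrr subrr. Qed.

Lemma mxfun_herm f X : mxfun f X \is hermsymmx.
Proof.
apply/hermP; rewrite mxfunE !adjM trmxCK -mulmxA; congr (_ *m (_ *m _)).
rewrite tr_diag_mx map_diag_mx; congr diag_mx.
by apply/rowP => k; rewrite !mxE; exact: conjc_real.
Qed.

Lemma mxfun_id X : X \is hermsymmx -> mxfun id X = X.
Proof.
move=> hX; rewrite [RHS](orthomx_spectralP (hermitian_normalmx hX)).
rewrite mxfunE (invmx_unitary (spectral_unitarymx X)) /fdiag.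
rewrite (_ : \row_k _ = spectral_diag X) //.
apply/rowP => k; rewrite !mxE /eigval RRe_real //.
exact: (mxOverP (hermitian_spectral_diag_real hX)).
Qed.

Lemma tr_mxfun f X : \tr (mxfun f X) = (\sum_k f (eigval X k))%:C.
Proof.
rewrite mxfunE mxtrace_mulC mulmxA spectralmxVr mul1mx mxtrace_diag rmorph_sum.
by apply: eq_bigr => k _; rewrite mxE.
Qed.

(** Coordinates in the orthonormal eigenbasis formed by the columns of the
    adjoint of [spectralmx X]. *)
Definition coor X v : V := spectralmx X *m v.

Lemma coorZ X (z : R[i]) v k : coor X (z *: v) k 0 = z * coor X v k 0.
Proof. by rewrite /coor -scalemxAr [LHS]mxE. Qed.

Lemma coor_mxfun f X v k :
  coor X (mxfun f X *m v) k 0 = (f (eigval X k))%:C * coor X v k 0.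
Proof.
rewrite /coor mxfunE !mulmxA spectralmxVr mul1mx -mulmxA mul_diag_mx.
by rewrite !mxE.
Qed.

Lemma coor_mulmx X v k : X \is hermsymmx ->
  coor X (X *m v) k 0 = (eigval X k)%:C * coor X v k 0.
Proof. by move=> hX; have := coor_mxfun id X v k; rewrite mxfun_id. Qed.

Lemma coor_inj X v w : (forall k, coor X v k 0 = coor X w k 0) -> v = w.
Proof.
move=> /colP vw.
by rewrite -[v]mul1mx -[w]mul1mx -(spectralmxVl X) -!mulmxA -/(coor X v) vw.
Qed.

(** An eigenvector for [a] has no coordinate along eigenvectors of [X] with
    another eigenvalue, so that [f X] acts on it as [f a] whichever eigenbasis
    the definition of [mxfun] has picked. *)
Lemma eigen_mxfun f X v a : X \is hermsymmx ->
  X *m v = a%:C *: v -> mxfun f X *m v = (f a)%:C *: v.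
Proof.
move=> hX Xv; apply: (@coor_inj X) => k; rewrite coor_mxfun.
have := coor_mulmx v k hX; rewrite Xv !coorZ; have [->|nz] := eqVneq (coor X v k 0) 0.
  by rewrite !mulr0.
by move=> /(mulIf nz) /complexI ->.
Qed.

Definition eigvec X (k : 'I_d) : V := col k ((spectralmx X)^t*).

Lemma coor_eigvec X k l : coor X (eigvec X k) l 0 = (l == k)%:R.
Proof.
by rewrite /coor /eigvec colE mulmxA spectralmxVr mul1mx !mxE andbT.
Qed.

Lemma mxfun_eigvec f X k :
  mxfun f X *m eigvec X k = (f (eigval X k))%:C *: eigvec X k.
Proof.
apply: (@coor_inj X) => l; rewrite coor_mxfun coorZ coor_eigvec.
by have [->|] := eqVneq l k; rewrite ?mulr0.
Qed.

Lemma mulmx_eigvec X k : X \is hermsymmx ->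
  X *m eigvec X k = (eigval X k)%:C *: eigvec X k.
Proof. by move=> hX; have := mxfun_eigvec id X k; rewrite mxfun_id. Qed.

(** With [mxfun_eigvec], this reduces an identity between functions of [X] to
    one between real numbers. *)
Lemma eigvec_inj X (A B : M) :
  (forall k, A *m eigvec X k = B *m eigvec X k) -> A = B.
Proof.
move=> AB; rewrite -[A]mulmx1 -[B]mulmx1 -(spectralmxVl X) !mulmxA.
congr (_ *m _); apply/matrixP => i k.
have := congr1 (fun w : V => w i 0) (AB k).
by rewrite /eigvec !colE !mulmxA -!colE ![col _ _ _ _]mxE.
Qed.

(** The two sides are diagonalized by possibly different eigenbases; both act
    on the eigenvectors of [X] in the same way. *)
Lemma mxfun_comp f g X : mxfun f (mxfun g X) = mxfun (f \o g) X.
Proof.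
apply: (@eigvec_inj X) => k; rewrite mxfun_eigvec.
by apply: eigen_mxfun; [exact: mxfun_herm|exact: mxfun_eigvec].
Qed.

Lemma qform_mxfun f X v :
  (v^t* *m mxfun f X *m v) 0 0 =
  (\sum_k f (eigval X k) * sqmod (coor X v k 0))%:C.
Proof.
rewrite mxfunE !mulmxA -adjM -mulmxA -/(coor X v) mul_mx_diag mxE rmorph_sum.
by apply: eq_bigr => k _; rewrite !mxE /= rmorphM /= sqmodE; ring.
Qed.

Lemma qform_herm X v : X \is hermsymmx ->
  (v^t* *m X *m v) 0 0 = (\sum_k eigval X k * sqmod (coor X v k 0))%:C.
Proof. by move=> hX; have := qform_mxfun id X v; rewrite mxfun_id. Qed.

Lemma qformB X Y v :
  (v^t* *m (X - Y) *m v) 0 0 = (v^t* *m X *m v) 0 0 - (v^t* *m Y *m v) 0 0.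
Proof.
by rewrite mulmxBr mulmxBl [LHS]mxE; congr (_ + _); rewrite [LHS]mxE.
Qed.

Lemma qform_eigvec X k : X \is hermsymmx ->
  ((eigvec X k)^t* *m X *m eigvec X k) 0 0 = (eigval X k)%:C.
Proof.
move=> hX; rewrite (qform_herm _ hX) (bigD1 k) //= coor_eigvec eqxx.
rewrite (_ : sqmod _ = 1) ?mulr1 ?big1 ?addr0 //.
  by move=> l lk; rewrite coor_eigvec (negbTE lk) sqmod_real expr0n mulr0.
by rewrite sqmod_real expr1n.
Qed.

End FunctionalCalculus.

(** * Positive matrices, orthogonal projections and the spectral order *)

Section Positive.
Context {R : realType} {d : nat}.
Local Notation M := 'M[R[i]]_d.
Local Notation V := 'cV[R[i]]_d.
Implicit Types (X Y E F G : M) (f g : R -> R) (v : V).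

Lemma psd_eigval_ge0 X k : psdmx X -> 0 <= eigval X k.
Proof.
by case=> hX /(_ (eigvec X k)); rewrite qform_eigvec // ler0c.
Qed.

Lemma psd_mxfun f X : (forall k, 0 <= f (eigval X k)) -> psdmx (mxfun f X).
Proof.
move=> f0; split; first exact: mxfun_herm.
move=> v; rewrite qform_mxfun ler0c sumr_ge0 // => k _.
by rewrite mulr_ge0 ?sqmod_ge0.
Qed.

Lemma psd_sum (I : finType) (P : pred I) (A : I -> M) :
  (forall i, psdmx (A i)) -> psdmx (\sum_(i | P i) A i).
Proof.
move=> hA; split; first by apply: herm_sum => i; case: (hA i).
move=> v; rewrite mulmx_sumr mulmx_suml summxE sumr_ge0 // => i _.
by case: (hA i).
Qed.

Lemma psd_trace_ge0 X : psdmx X -> 0 <= \tr X.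
Proof.
move=> pX; have [hX _] := pX.
rewrite -(mxfun_id hX) tr_mxfun ler0c sumr_ge0 // => k _.
exact: psd_eigval_ge0.
Qed.

(** If [B] is the square root of [X], the quadratic form of [X] at [v] is the
    squared length of [B v]. *)
Lemma psd_ker X v : psdmx X -> (v^t* *m X *m v) 0 0 = 0 -> X *m v = 0.
Proof.
move=> pX; have [hX _] := pX.
have XE : X = mxfun Num.sqrt X *m mxfun Num.sqrt X.
  rewrite mxfunM -{1}(mxfun_id hX); apply: mxfun_ext => k /=.
  by rewrite -expr2 sqr_sqrtr // psd_eigval_ge0.
have /hermP hB := mxfun_herm Num.sqrt X.
rewrite {1}XE -{1}hB mulmxA -adjM -mulmxA => /dot_eq0 B0.
by rewrite XE -mulmxA B0 mulmx0.
Qed.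

Lemma mulmx_col_eq0 n (X : M) (K : 'M[R[i]]_(d, n)) :
  (forall k, X *m col k K = 0) -> X *m K = 0.
Proof.
move=> XK; apply/matrixP => i k; have := congr1 (fun w : V => w i 0) (XK k).
by rewrite colE mulmxA -colE [col _ _ _ _]mxE => ->; rewrite !mxE.
Qed.

Lemma mulmx_1sub_eq0 X Y : X *m (1%:M - Y) = 0 -> X *m Y = X.
Proof. by rewrite mulmxBr mulmx1 => /eqP; rewrite subr_eq0 => /eqP. Qed.

(** The quadratic forms of the [A i] at a vector killed by their sum are
    nonnegative with zero sum; each vanishes, and [psd_ker] applies. *)
Lemma psd_sum_ker (I : finType) (P : pred I) (A : I -> M) n
    (K : 'M[R[i]]_(d, n)) :
  (forall i, psdmx (A i)) -> (\sum_(i | P i) A i) *m K = 0 ->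
  forall i, P i -> A i *m K = 0.
Proof.
move=> pA AK i Pi; apply: mulmx_col_eq0 => k; apply: psd_ker => //.
set v := col k K.
have q0 j : P j -> 0 <= (v^t* *m A j *m v) 0 0 by move=> _; case: (pA j).
apply: (psumr_eq0P q0) => //.
rewrite -summxE -mulmx_suml -mulmx_sumr -mulmxA /v colE (mulmxA _ K) AK.
by rewrite mul0mx mulmx0 mxE.
Qed.

Lemma herm_mul_absorb E F : E \is hermsymmx -> F \is hermsymmx ->
  E *m F = F <-> F *m E = F.
Proof.
move=> /hermP hE /hermP hF.
by split=> /(congr1 (fun X : M => X^t*)); rewrite adjM hE hF.
Qed.

Definition ortho_proj E : Prop := E \is hermsymmx /\ E *m E = E.

Lemma ortho_proj_qform E v : ortho_proj E ->
  (v^t* *m E *m v) 0 0 = ((E *m v)^t* *m (E *m v)) 0 0.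
Proof.
by case=> /hermP hE EE; rewrite adjM hE !mulmxA -(mulmxA _ E E) EE.
Qed.

Lemma ortho_proj_psd E : ortho_proj E -> psdmx E.
Proof.
move=> pE; split; first by case: pE.
move=> v; rewrite ortho_proj_qform // dot_sqmod ler0c sumr_ge0 // => k _.
exact: sqmod_ge0.
Qed.

(** If [E <= F] as quadratic forms, then the form of [E] vanishes on the kernel
    of [F], whence [E (1 - F) = 0]. If [F E = E], then [F - E] is an orthogonal
    projection. *)
Lemma ortho_proj_le E F : ortho_proj E -> ortho_proj F ->
  loewner_le E F <-> F *m E = E.
Proof.
move=> pE pF; have [hE EE] := pE; have [hF FF] := pF; split; last first.
  move=> FE; apply: ortho_proj_psd; split; first exact: hermB.
  have EF := (herm_mul_absorb hF hE).1 FE.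
  by rewrite mulmxBl !mulmxBr FF EF FE EE subrr subr0.
case=> _ le_EF; suff EF : E *m F = E.
  exact: (herm_mul_absorb hF hE).2 EF.
have: E *m (1%:M - F) = 0.
  apply: mulmx_col_eq0 => k; set w := col k _.
  have Fw : F *m w = 0 by rewrite /w colE mulmxA mulmxBr mulmx1 FF subrr mul0mx.
  apply: dot_eq0; rewrite -ortho_proj_qform //; apply/eqP; rewrite eq_le.
  apply/andP; split; last by case: (ortho_proj_psd pE).
  have := le_EF w; rewrite mulmxBr mulmxBl -(mulmxA _ F) Fw mulmx0 sub0r.
  by rewrite mxE oppr_ge0.
exact: mulmx_1sub_eq0.
Qed.

(** In a full-rank factorization [E = C R], idempotence forces [R C = 1]; the
    trace of [E] is that of this identity matrix of size [\rank E]. *)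
Lemma ortho_proj_trace E : ortho_proj E -> \tr E = (\rank E)%:R.
Proof.
case=> _; rewrite -{1 2 3 4}(mulmx_base E) => EE.
rewrite mxtrace_mulC.
suff -> : row_base E *m col_base E = 1%:M by rewrite mxtrace1.
apply: (row_free_inj (row_base_free E)); apply: (row_full_inj (col_base_full E)).
by rewrite mul1mx -EE !mulmxA.
Qed.

Lemma mxfun_ortho_proj f X : (forall x, f x * f x = f x) ->
  ortho_proj (mxfun f X).
Proof.
by move=> ff; split; [exact: mxfun_herm|rewrite mxfunM; apply: mxfun_ext].
Qed.

Lemma spectral_proj_ortho X t : ortho_proj (spectral_proj X t).
Proof. by apply: mxfun_ortho_proj => x; case: (t < x); rewrite ?mulr1 ?mulr0. Qed.

Lemma spectral_leP X Y : spectral_le X Y <->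
  forall t, spectral_proj Y t *m spectral_proj X t = spectral_proj X t.
Proof.
split=> H t; last first.
  exact/(ortho_proj_le (spectral_proj_ortho X t) (spectral_proj_ortho Y t)).
exact/(ortho_proj_le (spectral_proj_ortho X t) (spectral_proj_ortho Y t)).
Qed.

(** The spectral projections agree, and they separate eigenvalues: an
    eigenvector of [X] for [a] has no coordinate along an eigenvector of [Y] for
    [b != a], since some threshold [t] lies between [a] and [b]. *)
Lemma spectral_le_anti X Y : X \is hermsymmx -> Y \is hermsymmx ->
  spectral_le X Y -> spectral_le Y X -> X = Y.
Proof.
move=> hX hY /spectral_leP XY /spectral_leP YX.
have EE t : spectral_proj Y t = spectral_proj X t.
  have [hE _] := spectral_proj_ortho X t.
  have [hF _] := spectral_proj_ortho Y t.
  by rewrite -((herm_mul_absorb hE hF).1 (YX t)).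
apply: (@eigvec_inj _ _ X) => k; apply: (@coor_inj _ _ Y) => l.
rewrite (mulmx_eigvec k hX) (coor_mulmx _ l hY) coorZ.
set a := eigval X k; set b := eigval Y l; set c := coor _ _ _ _.
have Et t : (t < b)%R%:R%:C * c = (t < a)%R%:R%:C * c.
  rewrite /c -(coor_mxfun (fun x => (t < x)%R%:R)) -/(spectral_proj Y t) EE.
  by rewrite mxfun_eigvec coorZ.
have c0 : a != b -> c = 0.
  rewrite neq_lt => /orP[ab|ba].
    by have := Et a; rewrite ab ltxx mul1r mul0r.
  by have := Et b; rewrite ba ltxx mul1r mul0r => <-.
by have [->//|/c0 ->] := eqVneq a b; rewrite !mulr0.
Qed.

Lemma spectral_sup_unique m (A : 'I_m -> M) X Y :
  is_spectral_sup A X -> is_spectral_sup A Y -> X = Y.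
Proof.
case=> hX uX lX [hY uY lY].
exact: (spectral_le_anti hX hY (lX _ hY uY) (lY _ hX uX)).
Qed.

Lemma spectral_supE m (A : 'I_m -> M) X :
  is_spectral_sup A X -> spectral_sup A = X.
Proof.
move=> sX; apply: (spectral_sup_unique _ sX); rewrite /spectral_sup.
exact: (xgetI _ sX).
Qed.

End Positive.

(** * The trace inequality for one dominated summand *)

Section McCarthy.
Context {R : realType} {d : nat}.
Local Notation M := 'M[R[i]]_d.
Local Notation V := 'cV[R[i]]_d.
Implicit Types (X Y A S : M) (v : V) (p a s x : R).

(** With [x = exp u], both sides are compared with [1 + (p - 1) u], using
    [1 + y <= exp y] at [- u] and its strict form at [(p - 1) u]. *)
Lemma powR_gt_harmonic p x : 1 < p -> 0 < x -> x != 1 ->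
  p - (p - 1) / x < x `^ (p - 1).
Proof.
move=> p1 x0 x1; have p0 : 0 < p - 1 by rewrite subr_gt0.
set u := ln x; have xE : x = expR u by rewrite lnK.
have u0 : u != 0 by apply: contra x1; rewrite xE => /eqP ->; rewrite expR0.
have -> : x `^ (p - 1) = expR ((p - 1) * u) by rewrite /powR gt_eqF.
have H1 := expR_gt1Dx (mulf_neq0 (lt0r_neq0 p0) u0).
apply: le_lt_trans H1; rewrite xE -expRN.
have := expR_ge1Dx (- u); nra.
Qed.

(** The tangent inequality of the convex function [s `^ p] at [a], divided by
    [s]. In this form it bounds [s `^ (p - 1)] for all [p > 1], although this
    function is concave when [p < 2]. *)
Lemma powR_gt_tangent p a s : 1 < p -> 0 < a -> 0 < s -> s != a ->
  p * a `^ (p - 1) - (p - 1) * a `^ (p - 1) * (a / s) < s `^ (p - 1).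
Proof.
move=> p1 a0 s0 sa; set x := s / a.
have x0 : 0 < x by rewrite divr_gt0.
have x1 : x != 1 by apply: contra sa => /eqP /divr1_eq ->.
have -> : s = a * x by rewrite /x mulrC divfK // gt_eqF.
rewrite powRM ?ltW // (_ : a / (a * x) = x^-1); last first.
  by field; rewrite !gt_eqF.
have := powR_gt_harmonic p1 x0 x1; rewrite -(ltr_pM2l (powR_gt0 (p - 1) a0)).
by apply: le_lt_trans; rewrite le_eqVlt; apply/orP; left; apply/eqP; ring.
Qed.

Lemma coorE X v k : coor X v k 0 = ((eigvec X k)^t* *m v) 0 0.
Proof.
by rewrite !mxE; apply: eq_bigr => l _; rewrite !mxE conjCK.
Qed.

(** Both sides are the squared modulus of the same inner product. *)
Lemma sqmod_coor_sym X Y k l :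
  sqmod (coor X (eigvec Y l) k 0) = sqmod (coor Y (eigvec X k) l 0).
Proof.
rewrite !coorE -[RHS]sqmodC; congr sqmod.
rewrite !mxE rmorph_sum; apply: eq_bigr => i _ /=.
by rewrite rmorphM /= [LHS]mulrC; congr (_ * _); rewrite !mxE ?conjCK.
Qed.

Lemma sum_sqmod_coor X v : (\sum_l sqmod (coor X v l 0))%:C = (v^t* *m v) 0 0.
Proof.
have := qform_mxfun (fun=> 1) X v; rewrite mxfun1 mulmx1 => ->.
by congr (_%:C); apply: eq_bigr => l _; rewrite mul1r.
Qed.

Lemma sum_sqmod_coor_eigvec X Y k : \sum_l sqmod (coor X (eigvec Y k) l 0) = 1.
Proof.
by apply: complexI; rewrite sum_sqmod_coor -coorE coor_eigvec eqxx.
Qed.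

Lemma tr_mulmx_herm X A : A \is hermsymmx ->
  \tr (X *m A) =
  \sum_k (eigval A k)%:C * ((eigvec A k)^t* *m X *m eigvec A k) 0 0.
Proof.
move=> hA; rewrite -{1}(mxfun_id hA) mxfunE !mulmxA mxtrace_mulC !mulmxA.
apply: eq_bigr => k _; rewrite mul_mx_diag [LHS]mxE [X in _ * X]mxE mulrC; congr (_ * _).
by rewrite -(mulmxA ((eigvec A k)^t*)) -coorE /coor /eigvec colE !mulmxA -colE [RHS]mxE.
Qed.

Section Dominated.
Context {S A : M} (psdS : psdmx S) (psdA : psdmx A) (le_AS : psdmx (S - A)).

(** The squared overlap of the [k]-th eigenvector of [A] with the [l]-th
    eigenvector of [S]; it is a doubly stochastic matrix. *)
Let q k l := sqmod (coor S (eigvec A k) l 0).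

(** This is [A <= S] evaluated at the [l]-th eigenvector of [S]. *)
Lemma overlap_diag_le l :
  \sum_k eigval A k * q k l <= eigval S l.
Proof.
have [hS _] := psdS; have [hA _] := psdA.
have [_ /(_ (eigvec S l))] := le_AS.
rewrite qformB qform_eigvec // qform_herm // -rmorphB ler0c subr_ge0.
by under eq_bigr do rewrite sqmod_coor_sym.
Qed.

(** The kernel of [S] is contained in that of [A], hence orthogonal to the
    eigenvectors of [A] with positive eigenvalue. *)
Lemma overlap_ker k l : 0 < eigval A k -> eigval S l = 0 -> q k l = 0.
Proof.
move=> a0 s0; apply/eqP; rewrite eq_le sqmod_ge0 andbT -(pmulr_rle0 _ a0).
apply: le_trans (_ : eigval S l <= 0); last by rewrite s0.
apply: le_trans (overlap_diag_le l); rewrite (bigD1 k) //= lerDl sumr_ge0 //.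
by move=> j _; rewrite mulr_ge0 ?sqmod_ge0 ?psd_eigval_ge0.
Qed.

(** Let [u] be the [k]-th eigenvector of [A], [a] its eigenvalue, [y] the image
    of [u] under the pseudo-inverse of [S], and [z] the sum, which equals both
    [<u, y>] and [<y, S y>]. Then [a z^2 <= <y, A y> <= <y, S y> = z]. Since the
    inverse of [0] is [0], [GRing.inv] yields the pseudo-inverse. *)
Lemma overlap_inv_le k : eigval A k * \sum_l q k l / eigval S l <= 1.
Proof.
have [hS _] := psdS; have [hA _] := psdA.
set z := \sum_l _; have a0 := psd_eigval_ge0 k psdA.
have z0 : 0 <= z.
  rewrite sumr_ge0 // => l _.
  by rewrite mulr_ge0 ?sqmod_ge0 ?invr_ge0 ?psd_eigval_ge0.
pose y := mxfun GRing.inv S *m eigvec A k.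
have coorA : coor A y k 0 = z%:C.
  rewrite coorE /y mulmxA qform_mxfun; congr (_%:C).
  by apply: eq_bigr => l _; rewrite mulrC.
have yAy : (eigval A k * z ^+ 2)%:C <= (y^t* *m A *m y) 0 0.
  rewrite (qform_herm _ hA) lecR (bigD1 k) //= coorA sqmod_real.
  rewrite lerDl sumr_ge0 // => j _.
  by rewrite mulr_ge0 ?sqmod_ge0 ?psd_eigval_ge0.
have ySy : (y^t* *m S *m y) 0 0 = z%:C.
  rewrite (qform_herm _ hS); congr (_%:C).
  apply: eq_bigr => l _; rewrite /y coor_mxfun sqmodM sqmod_real -/(q k l).
  have [->|s0] := eqVneq (eigval S l) 0; first by rewrite invr0 mul0r mulr0.
  by field.
have := proj2 le_AS y; rewrite qformB subr_ge0 ySy.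
move=> /(le_trans yAy); rewrite lecR => az.
have [->|z1] := eqVneq z 0; first by rewrite mulr0.
by rewrite -(ler_pM2r (_ : 0 < z)) ?lt_def ?z1 // mul1r -mulrA -expr2.
Qed.

Lemma tr_powR_mul p : \tr (mxfun (fun x => x `^ (p - 1)) S *m A) =
  (\sum_k eigval A k * \sum_l eigval S l `^ (p - 1) * q k l)%:C.
Proof.
have [hA _] := psdA; rewrite tr_mulmx_herm // rmorph_sum; apply: eq_bigr => k _.
by rewrite qform_mxfun rmorphM.
Qed.

(** The error made in the tangent inequality at the [l]-th eigenvalue of [S],
    weighted by the overlap. *)
Let gap p k l := q k l * (eigval S l `^ (p - 1) -
  (p * eigval A k `^ (p - 1) -
   (p - 1) * eigval A k `^ (p - 1) * (eigval A k / eigval S l))).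

Lemma gap_ge0 p k l : 1 < p -> 0 < eigval A k -> 0 <= gap p k l.
Proof.
move=> p1 a0; rewrite /gap.
have := psd_eigval_ge0 l psdS; rewrite le_eqVlt => /orP[/eqP s0|s0].
  by rewrite overlap_ker // mul0r.
rewrite mulr_ge0 ?sqmod_ge0 // subr_ge0.
have [->|sa] := eqVneq (eigval S l) (eigval A k); last exact/ltW/powR_gt_tangent.
by rewrite divff ?gt_eqF //; lra.
Qed.

Lemma gap_eq0 p k l : 1 < p -> 0 < eigval A k -> gap p k l = 0 ->
  q k l != 0 -> eigval S l = eigval A k.
Proof.
move=> p1 a0 + q0; rewrite /gap => /eqP; rewrite mulf_eq0 (negbTE q0) /= => g0.
have s0 : 0 < eigval S l.
  rewrite lt_def psd_eigval_ge0 // andbT.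
  by apply: contra q0 => /eqP /overlap_ker ->.
apply/eqP; apply: contraLR g0 => sa; rewrite subr_eq0 gt_eqF //.
exact: powR_gt_tangent.
Qed.

(** The overlaps have sum [1], and [overlap_inv_le] bounds the term in [1 / s]. *)
Lemma sum_gap_le p k : 1 < p -> \sum_l gap p k l <=
  \sum_l eigval S l `^ (p - 1) * q k l - eigval A k `^ (p - 1).
Proof.
move=> p1; set a := eigval A k; pose z := \sum_l q k l / eigval S l.
have -> : \sum_l gap p k l = \sum_l eigval S l `^ (p - 1) * q k l -
    p * a `^ (p - 1) * \sum_l q k l + (p - 1) * a `^ (p - 1) * (a * z).
  rewrite /z !mulr_sumr -sumrB -big_split /=; apply: eq_bigr => l _.
  by rewrite /gap -/a; ring.
rewrite sum_sqmod_coor_eigvec.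
have p0 : 0 <= p - 1 by rewrite subr_ge0 ltW.
have := ler_wpM2l (mulr_ge0 p0 (powR_ge0 a (p - 1))) (overlap_inv_le k).
by rewrite -/z -/a; lra.
Qed.

Lemma eigval_powR_le p k : 1 < p ->
  eigval A k `^ p <= eigval A k * \sum_l eigval S l `^ (p - 1) * q k l.
Proof.
move=> p1; have a_ge0 := psd_eigval_ge0 k psdA.
have [->|a_neq0] := eqVneq (eigval A k) 0.
  by rewrite mul0r powR0 // gt_eqF // (lt_trans ltr01).
have a0 : 0 < eigval A k by rewrite lt_def a_neq0.
rewrite -mulr_powRB1 ?(lt_trans ltr01) // ler_pM2l // -subr_ge0.
apply: le_trans (sum_gap_le k p1); apply: sumr_ge0 => l _; exact: gap_ge0.
Qed.

(** All the gaps vanish, so that an eigenvector of [S] overlapping the [k]-th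
    eigenvector of [A] has the same eigenvalue. *)
Lemma eigval_powR_eq p k l : 1 < p ->
  eigval A k `^ p = eigval A k * \sum_l eigval S l `^ (p - 1) * q k l ->
  eigval A k * (eigval S l - eigval A k) * q k l = 0.
Proof.
move=> p1 eq_p; have a_ge0 := psd_eigval_ge0 k psdA.
have [->|a_neq0] := eqVneq (eigval A k) 0; first by rewrite !mul0r.
have a0 : 0 < eigval A k by rewrite lt_def a_neq0.
have [->|q0] := eqVneq (q k l) 0; first by rewrite mulr0.
suff -> : eigval S l = eigval A k by rewrite subrr mulr0 mul0r.
apply: (@gap_eq0 p) => //.
apply: (psumr_eq0P (P := xpredT) (F := gap p k)) => //.
  by move=> j _; exact: gap_ge0.
apply/eqP; rewrite eq_le sumr_ge0 ?andbT; last by move=> j _; exact: gap_ge0.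
apply: le_trans (sum_gap_le k p1) _; rewrite subr_le0.
move: eq_p; rewrite -mulr_powRB1 ?(lt_trans ltr01) //.
by move=> /(mulfI a_neq0) ->.
Qed.

Lemma sum_powR_le_tr p : 1 < p -> (\sum_k eigval A k `^ p)%:C <=
  \tr (mxfun (fun x => x `^ (p - 1)) S *m A).
Proof.
by move=> p1; rewrite tr_powR_mul lecR ler_sum // => k _; exact: eigval_powR_le.
Qed.

(** In the eigenbases of [S] and [A], the matrix entries of [S A - A A] are the
    inner products of eigenvectors times [(s - a) a]; these are the products
    that [eigval_powR_eq] annihilates. *)
Lemma sum_powR_eq_tr p : 1 < p ->
  (\sum_k eigval A k `^ p)%:C = \tr (mxfun (fun x => x `^ (p - 1)) S *m A) ->
  S *m A = A *m A.
Proof.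
move=> p1; rewrite tr_powR_mul => /complexI /eqP; rewrite eq_sym -subr_eq0 -sumrB.
move=> /eqP sum0; have [hS _] := psdS; have [hA _] := psdA.
have eq_k k : eigval A k `^ p =
    eigval A k * \sum_l eigval S l `^ (p - 1) * q k l.
  apply/esym/eqP; rewrite -subr_eq0; apply/eqP.
  move: k (erefl (xpredT k)); apply: (psumr_eq0P _ sum0) => k _.
  by rewrite subr_ge0 eigval_powR_le.
apply: (@eigvec_inj _ _ A) => k; apply: (@coor_inj _ _ S) => l.
have Au := mulmx_eigvec k hA.
rewrite -(mulmxA S) Au -(mulmxA A) Au -!scalemxAr Au !coorZ.
rewrite (coor_mulmx _ l hS).
have /eqP := eigval_powR_eq l p1 (eq_k k); rewrite !mulf_eq0 sqmod_eq0 subr_eq0.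
by move=> /orP[/orP[]|] /eqP ->; rewrite ?mul0r ?mulr0.
Qed.

End Dominated.

End McCarthy.

(** * Sums controlled by counting functions *)

Section Counting.
Context {R : realType} (f : R -> R) (f0 : f 0 = 0).
Context (f_homo : forall x y, 0 <= x -> x <= y -> f x <= f y).

Let f_ge0 x : 0 <= x -> 0 <= f x.
Proof. by move=> x0; rewrite -f0 f_homo. Qed.

Let above (x : R) : pred R := fun y => x < y.

(** The largest entries satisfy [x <= y], as seen by counting above [y] if
    [y < x]. Removing both keeps the hypothesis: below [x] each count drops by
    one, and above [x] the first count is zero. *)
Lemma sum_le_count_sorted (s t : seq R) :
  sorted >=%R s -> sorted >=%R t ->
  all (fun x => 0 <= x) s -> all (fun x => 0 <= x) t ->
  (forall x, 0 <= x -> (count (above x) s <= count (above x) t)%N) ->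
  \sum_(x <- s) f x <= \sum_(x <- t) f x.
Proof.
elim: s t => [|x s IH] t.
  move=> _ _ _ /allP t0 _; rewrite big_nil big_seq sumr_ge0 // => y yt.
  exact/f_ge0/t0.
case: t => [|y t] s_sort t_sort.
  move=> /allP s0 _ /(_ 0 (lexx _)); rewrite leqn0 eqn0Ngt -has_count.
  move=> /hasPn s_le0; rewrite big_nil big1_seq // => z /andP[_ zs].
  suff -> : z = 0 by [].
  by apply/eqP; rewrite eq_le s0 // andbT leNgt; exact: s_le0.
have ge_trans : transitive (>=%R : rel R) by move=> a b c /[swap]; exact: le_trans.
have /allP s_le := order_path_min ge_trans s_sort.
have /allP t_le := order_path_min ge_trans t_sort.
move=> /= /andP[x0 s0] /andP[y0 t0] cnt.
have none (z w : R) u : {in u, forall b, b <= w} -> w <= z -> count (above z) u = 0%N.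
  move=> uw wz; apply/eqP; rewrite eqn0Ngt -has_count; apply/hasPn => b /uw bw.
  by rewrite /above -leNgt (le_trans bw).
have xy : x <= y.
  rewrite leNgt; apply/negP => yx; have := cnt y y0.
  by rewrite (none y y t t_le) // /above yx ltxx.
rewrite !big_cons lerD ?f_homo //; apply: IH => //.
- exact: path_sorted s_sort.
- exact: path_sorted t_sort.
move=> z z0; have [zx|xz] := ltP z x; last by rewrite (none z x s s_le).
by have := cnt z z0; rewrite /above zx (lt_le_trans zx xy) leq_add2l.
Qed.

Lemma sum_le_count (s t : seq R) :
  all (fun x => 0 <= x) s -> all (fun x => 0 <= x) t ->
  (forall x, 0 <= x -> (count (above x) s <= count (above x) t)%N) ->
  \sum_(x <- s) f x <= \sum_(x <- t) f x.
Proof.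
move=> s0 t0 cnt; have tot : total (>=%R : rel R) by move=> a b; exact: le_total.
rewrite -(perm_big _ (permEl (perm_sort >=%R s))).
rewrite -(perm_big _ (permEl (perm_sort >=%R t))).
apply: sum_le_count_sorted; rewrite ?all_sort ?sort_sorted //.
by move=> x x0; rewrite !count_sort cnt.
Qed.

End Counting.

(** * Eigenvalues of a spectral supremum *)

Lemma sumr_sub_term (V : zmodType) (I : finType) (F : I -> V) j :
  \sum_i F i - F j = \sum_(i | i != j) F i.
Proof. by rewrite (bigD1 j) //= addrAC subrr add0r. Qed.

Lemma mxrank_sum_le (F : fieldType) (I : finType) m n (B : I -> 'M[F]_(m, n)) :
  (\rank (\sum_i B i)%R <= \sum_i \rank (B i))%N.
Proof.
elim/big_rec2: _ => [|i k X _ le_kX]; first by rewrite mxrank0.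
by apply: leq_trans (mxrank_add _ _) _; rewrite leq_add2l.
Qed.

Lemma mulmx_absorb (V : pzSemiRingType) n (P E F : 'M[V]_n) :
  P *m E = E -> E *m F = F -> P *m F = F.
Proof. by move=> PE EF; rewrite -EF mulmxA PE. Qed.

Section Supremum.
Context {R : realType} {d m : nat} (A : 'I_m -> 'M[R[i]]_d).
Local Notation M := 'M[R[i]]_d.
Implicit Types (B C X : M) (t s p : R).

Lemma psd0 : psdmx (0 : M).
Proof. by rewrite -(mxfun0 0); exact: psd_mxfun. Qed.

Lemma tr_spectral_proj X t :
  \tr (spectral_proj X t) = (\sum_k (t < eigval X k)%R%:R)%:C.
Proof. exact: tr_mxfun. Qed.

Lemma spectral_proj_lt0 X t : psdmx X -> t < 0 -> spectral_proj X t = 1%:M.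
Proof.
move=> pX t0; rewrite -(mxfun1 X); apply: mxfun_ext => k.
by rewrite (lt_le_trans t0) // psd_eigval_ge0.
Qed.

Lemma natr_count (I : Type) (r : seq I) (P : pred I) :
  (count P r)%:R = \sum_(i <- r) (P i)%:R :> R.
Proof.
by elim: r => [|i r IH] /=; rewrite ?big_nil // big_cons natrD IH.
Qed.

(** Let [P] be the projection onto the sum of the ranges of the [E j]. The
    matrix [B] equal to a large [K] on the range of [P] and to [t] on its
    orthogonal complement is an upper bound, so [E_C(t) <= E_B(t) = P], and the
    rank of [P] is at most the sum of the ranks of the [E j]. *)
Lemma sup_tr_proj_le C t : is_spectral_sup A C ->
  \tr (spectral_proj C t) <= \sum_j \tr (spectral_proj (A j) t).
Proof.
case=> hC ub lub; pose E j := spectral_proj (A j) t.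
have oE j : ortho_proj (E j) by exact: spectral_proj_ortho.
(* The range of N is the sum of the ranges of the E j, and P projects onto it. *)
pose N := \sum_j E j.
have pN : psdmx N by apply: psd_sum => j; exact: ortho_proj_psd.
have [hN _] := pN.
pose P := spectral_proj N 0; have oP : ortho_proj P := spectral_proj_ortho N 0.
have PE j : P *m E j = E j.
  have NP : N *m P = N.
    rewrite -{1}(mxfun_id hN) mxfunM -[RHS](mxfun_id hN); apply: mxfun_ext => k.
    have := psd_eigval_ge0 k pN; rewrite le_eqVlt => /orP[/eqP <-|->].
      by rewrite mul0r.
    by rewrite mulr1.
  have N1P : N *m (1%:M - P) = 0 by rewrite mulmxBr mulmx1 NP subrr.
  have /(_ j isT) := psd_sum_ker (fun i => ortho_proj_psd (oE i)) N1P.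
  move=> /mulmx_1sub_eq0 EP.
  by case: (oE j) oP => hE _ [hP _]; exact: (herm_mul_absorb hP hE).2 EP.
(* K exceeds t and every eigenvalue of every A j. *)
pose K := `|t| + 1 + \sum_j \sum_k `|eigval (A j) k|.
have row_ge0 j (Q : pred 'I_d) : 0 <= \sum_(k | Q k) `|eigval (A j) k|.
  by rewrite sumr_ge0.
have eK j k : eigval (A j) k <= K.
  rewrite (le_trans (ler_norm _)) // /K (bigD1 j) //= (bigD1 k) //=.
  have rest : 0 <= \sum_(i < m | i != j) \sum_k `|eigval (A i) k|.
    by rewrite sumr_ge0.
  by have := row_ge0 j (fun l => l != k); have := normr_ge0 t; lra.
have tK : t < K.
  have : 0 <= \sum_j \sum_k `|eigval (A j) k| by rewrite sumr_ge0.
  by have := ler_norm t; rewrite /K; lra.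
pose B := mxfun (fun x => if 0 < x then K else t) N.
have EB s : spectral_proj B s =
    mxfun (fun x => (s < (if 0 < x then K else t))%R%:R) N.
  by rewrite /spectral_proj /B mxfun_comp.
have EB_mid s : t <= s -> s < K -> spectral_proj B s = P.
  move=> ts sK; rewrite EB; apply: mxfun_ext => k.
  by case: ifP => _; rewrite ?sK // ltNge ts.
(* For s < t, E_B(s) is the identity; for t <= s < K it is P; for K <= s the
   spectral projection of A j vanishes. *)
have AB j : spectral_le (A j) B.
  apply/spectral_leP => s; have [st|ts] := ltP s t.
    rewrite EB (_ : mxfun _ N = 1%:M) ?mul1mx // -(mxfun1 N).
    by apply: mxfun_ext => k; case: ifP => _; rewrite ?st // (lt_trans st).
  have [sK|Ks] := ltP s K.
    rewrite (EB_mid s ts sK).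
    apply: mulmx_absorb (PE j) _.
    rewrite mxfunM; apply: mxfun_ext => k.
    have [sk|] := ltP s (eigval (A j) k); last by rewrite mulr0.
    by rewrite (le_lt_trans ts) // mulr1.
  rewrite (_ : spectral_proj (A j) s = 0) ?mulmx0 // -(mxfun0 (A j)).
  by apply: mxfun_ext => k; rewrite ltNge (le_trans (eK j k) Ks).
have := lub B (mxfun_herm _ _) AB t; rewrite (EB_mid t (lexx t) tK).
move=> /psd_trace_ge0; rewrite raddfB subr_ge0 /= => /le_trans; apply.
rewrite (ortho_proj_trace oP) (eq_bigr (fun j => (\rank (E j))%:R)); last first.
  by move=> j _; exact: (ortho_proj_trace (oE j)).
rewrite -natr_sum ler_nat (leq_trans _ (mxrank_sum_le E)) // -/N.
have -> : P = N *m mxfun GRing.inv N.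
  rewrite -[X in _ = X *m _](mxfun_id hN) mxfunM; apply: mxfun_ext => k.
  have := psd_eigval_ge0 k pN; rewrite le_eqVlt => /orP[/eqP <-|k0].
    by rewrite ltxx mul0r.
  by rewrite k0 divff // gt_eqF.
exact: (mxrankM_maxl N).
Qed.

(** For [t < 0], [E_C(t)] dominates [E_(A j)(t) = 1], so that no eigenvalue of
    [C] is negative. *)
Lemma sup_psd C : (0 < m)%N -> (forall j, psdmx (A j)) ->
  is_spectral_sup A C -> psdmx C.
Proof.
move=> m0 pA [hC ub _]; rewrite -(mxfun_id hC); apply: psd_mxfun => k.
rewrite leNgt; apply/negP => c0; pose j := Ordinal m0.
have /spectral_leP /(_ (eigval C k)) := ub j.
rewrite (spectral_proj_lt0 (pA j) c0) mulmx1 => E1.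
have := mxfun_eigvec (fun x => (eigval C k < x)%R%:R) C k.
rewrite -/(spectral_proj C _) E1 mul1mx ltxx scale0r.
move=> /(congr1 (fun v => coor C v k 0)).
by rewrite coor_eigvec eqxx /coor mulmx0 mxE => /eqP; rewrite oner_eq0.
Qed.

Lemma sup_sum_powR_le C p : (forall j, psdmx (A j)) -> psdmx C -> 0 < p ->
  is_spectral_sup A C ->
  \sum_k eigval C k `^ p <= \sum_j \sum_k eigval (A j) k `^ p.
Proof.
move=> pA pC p0 supC.
rewrite pair_big /= -(big_map (eigval C) xpredT (fun x => x `^ p)).
rewrite -(big_map (fun jk => eigval (A jk.1) jk.2) xpredT (fun x => x `^ p)).
apply: sum_le_count.
- by rewrite powR0 // gt_eqF.
- move=> x y x0 xy; apply: ge0_ler_powR; rewrite ?nnegrE ?(ltW p0) //.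
  exact: le_trans xy.
- by apply/allP => _ /mapP[k _ ->]; exact: (psd_eigval_ge0 k pC).
- by apply/allP => _ /mapP[jk _ ->]; exact: (psd_eigval_ge0 _ (pA _)).
move=> t _; have := sup_tr_proj_le t supC; rewrite tr_spectral_proj.
rewrite (eq_bigr (fun j => (\sum_k (t < eigval (A j) k)%R%:R)%:C)); last first.
  by move=> j _; exact: tr_spectral_proj.
rewrite -(rmorph_sum (real_complex R)) lecR pair_big /= -!natr_count ler_nat.
by rewrite !count_map.
Qed.

End Supremum.

(** * Orthogonal families *)

Section Orthogonal.
Context {R : realType} {d m : nat} (A : 'I_m -> 'M[R[i]]_d).
Local Notation M := 'M[R[i]]_d.
Context (orthA : forall i j, i != j -> A i *m A j = 0).

(** Let [v] be an eigenvector of the sum for [s]. Each [A i v] is killed by the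
    other summands and is an eigenvector of [A i] for [s]. If [s != 0], then [v]
    is the sum of the [s^-1 A i v], and [f 0 = 0] removes the cross terms; if
    [s = 0], all the [A i v] vanish. *)
Lemma mxfun_sum_ortho f : (forall j, A j \is hermsymmx) -> f 0 = 0 ->
  mxfun f (\sum_j A j) = \sum_j mxfun f (A j).
Proof.
move=> hA f0; set S := \sum_j A j.
have hS : S \is hermsymmx by exact: herm_sum.
apply: (@eigvec_inj _ _ S) => k; rewrite mxfun_eigvec mulmx_suml.
have Sv := mulmx_eigvec k hS; set v := eigvec S k in Sv *; set s := eigval S k in Sv *.
have AAv i : A i *m (A i *m v) = s%:C *: (A i *m v).
  rewrite scalemxAr -Sv mulmx_suml mulmx_sumr (bigD1 i) //= big1 ?addr0 // => j ji.
  by rewrite mulmxA orthA ?mul0mx // eq_sym.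
have fv_diag i := eigen_mxfun f (hA i) (AAv i).
have fv_off i j : j != i -> mxfun f (A i) *m (A j *m v) = 0.
  move=> ji; rewrite (eigen_mxfun (a := 0) f (hA i)) ?f0 ?scale0r //.
  by rewrite mulmxA orthA ?mul0mx // eq_sym.
have [s0|s0] := eqVneq s 0.
  rewrite s0 f0 scale0r big1 // => i _.
  rewrite (eigen_mxfun (a := 0) f (hA i)) ?f0 ?scale0r //.
  (* Here A i (A i v) = 0, so the squared length of A i v is zero. *)
  apply: dot_eq0; rewrite adjM (hermP _ (hA i)) -mulmxA AAv s0 scale0r.
  by rewrite mulmx0 mxE.
have s0C : s%:C != 0 by rewrite -(inj_eq (@complexI R)) in s0.
have vE : v = s%:C^-1 *: \sum_j A j *m v.
  by rewrite -mulmx_suml Sv scalerA mulVf // scale1r.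
transitivity (s%:C^-1 *: \sum_i (f s)%:C *: (A i *m v)).
  by rewrite -scaler_sumr {1}vE !scalerA mulrC.
rewrite scaler_sumr; apply: eq_bigr => i _.
rewrite [in RHS]vE -scalemxAr mulmx_sumr (bigD1 i) //= fv_diag.
by rewrite big1 ?addr0 // => j ji; exact: fv_off.
Qed.

(** For [t < 0] all the projections involved are [1]; for [t >= 0] the
    projection of the sum is the sum of the projections of the [A j], so it
    dominates each of them, and an [E_B(t)] fixing all their ranges fixes its
    range. *)
Lemma sum_ortho_is_sup : (0 < m)%N -> (forall j, psdmx (A j)) ->
  is_spectral_sup A (\sum_j A j).
Proof.
move=> m0 pA; have hA j : A j \is hermsymmx by case: (pA j).
have pS : psdmx (\sum_j A j) by exact: psd_sum.
have E_ge0 t : 0 <= t ->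
    spectral_proj (\sum_j A j) t = \sum_j spectral_proj (A j) t.
  by move=> t0; apply: mxfun_sum_ortho => //; rewrite ltNge t0.
split; first by case: pS.
  move=> j t; have [t0|t0] := ltP t 0.
    rewrite (spectral_proj_lt0 (pA j) t0) (spectral_proj_lt0 pS t0).
    by rewrite /loewner_le subrr; exact: psd0.
  rewrite (E_ge0 t t0) /loewner_le sumr_sub_term.
  by apply: psd_sum => i; exact/ortho_proj_psd/spectral_proj_ortho.
move=> B hB AB; apply/spectral_leP => t; have [t0|t0] := ltP t 0.
  have /spectral_leP /(_ t) := AB (Ordinal m0).
  by rewrite (spectral_proj_lt0 (pA _) t0) (spectral_proj_lt0 pS t0).
rewrite (E_ge0 t t0) mulmx_sumr; apply: eq_bigr => j _.
by have /spectral_leP := AB j.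
Qed.

End Orthogonal.

(** * McCarthy's inequality and its equality case *)

Section SumOfPowers.
Context {R : realType} {d m : nat} (A : 'I_m -> 'M[R[i]]_d).
Local Notation M := 'M[R[i]]_d.
Context (psdA : forall j, psdmx (A j)).
Let S := \sum_j A j.

Let psdS : psdmx S. Proof. exact: psd_sum. Qed.

Let le_AS j : psdmx (S - A j).
Proof. by rewrite sumr_sub_term; exact: psd_sum. Qed.

Let tr_powR p : 0 < p ->
  (\sum_k eigval S k `^ p)%:C =
  \sum_j \tr (mxfun (fun x => x `^ (p - 1)) S *m A j).
Proof.
move=> p0; rewrite -(raddf_sum (@mxtrace _ d)) -mulmx_sumr -/S.
rewrite -(tr_mxfun (fun x => x `^ p)); congr (\tr _).
have [hS _] := psdS; rewrite -[X in _ *m X](mxfun_id hS) mxfunM.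
by apply: mxfun_ext => k; rewrite mulrC mulr_powRB1 ?psd_eigval_ge0.
Qed.

Lemma mccarthy_le p : 1 < p ->
  \sum_j \sum_k eigval (A j) k `^ p <= \sum_k eigval S k `^ p.
Proof.
move=> p1; rewrite -lecR tr_powR ?(lt_trans ltr01) // rmorph_sum ler_sum // => j _.
exact: (sum_powR_le_tr psdS (psdA j) (le_AS j) p1).
Qed.

(** Equality in the sum forces [S A j = A j A j] for each [j], that is, the sum
    of the other [A i] annihilates [A j]; these are positive, so each does. *)
Lemma mccarthy_eq p : 1 < p ->
  \sum_j \sum_k eigval (A j) k `^ p = \sum_k eigval S k `^ p ->
  forall i j, i != j -> A i *m A j = 0.
Proof.
move=> p1 /(congr1 (fun x => x%:C)).
rewrite tr_powR ?(lt_trans ltr01) // rmorph_sum => /esym/eqP.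
rewrite -subr_eq0 -sumrB => /eqP sum0 i j ij.
have SA : S *m A j = A j *m A j.
  apply: (sum_powR_eq_tr psdS (psdA j) (le_AS j) p1); apply/esym/eqP.
  rewrite -subr_eq0; apply/eqP.
  move: j (erefl (xpredT j)) {ij}; apply: (psumr_eq0P _ sum0) => j _.
  by rewrite subr_ge0; exact: (sum_powR_le_tr psdS (psdA j) (le_AS j) p1).
apply: (psd_sum_ker (P := fun i => i != j) psdA) ij.
by apply: (addrI (A j *m A j)); rewrite addr0 -mulmxDl -[RHS]SA /S [in RHS](bigD1 j).
Qed.

End SumOfPowers.

(** * Schatten norms and the theorem *)

Section Main.
Context {R : realType} {d m : nat} (A : 'I_m -> 'M[R[i]]_d).

Lemma eigval0 k : eigval (0 : 'M[R[i]]_d) k = 0.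
Proof.
apply: complexI; rewrite -qform_eigvec; last exact: herm0.
by rewrite mulmx0 mul0mx mxE.
Qed.

Lemma absmx_psd (X : 'M[R[i]]_d) : psdmx X -> absmx X = X.
Proof.
move=> pX; have [hX _] := pX; rewrite /absmx (hermP _ hX).
have -> : X *m X = mxfun (fun x => x * x) X by rewrite -mxfunM mxfun_id.
rewrite mxfun_comp -[RHS](mxfun_id hX); apply: mxfun_ext => k /=.
by rewrite -expr2 sqrtr_sqr ger0_norm // psd_eigval_ge0.
Qed.

Lemma schatten_norm_psd p (X : 'M[R[i]]_d) : psdmx X ->
  schatten_norm p X = (\sum_k eigval X k `^ p) `^ p^-1.
Proof. by move=> pX; rewrite /schatten_norm absmx_psd // tr_mxfun. Qed.

(** Both claims also hold for the default value [0] of [spectral_sup]; that a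
    supremum exists is established for orthogonal families only, in
    [sum_ortho_is_sup]. *)
Lemma spectral_sup_spec p : (0 < m)%N -> (forall j, psdmx (A j)) -> 0 < p ->
  psdmx (spectral_sup A) /\
  \sum_k eigval (spectral_sup A) k `^ p <= \sum_j \sum_k eigval (A j) k `^ p.
Proof.
move=> m0 pA p0; have [[C supC]|no_sup] := pselect (exists C, is_spectral_sup A C).
  rewrite (spectral_supE supC); have pC := sup_psd m0 pA supC.
  by split=> //; exact: sup_sum_powR_le.
rewrite /spectral_sup xgetPN; last by move=> C supC; apply: no_sup; exists C.
split; first exact: psd0.
rewrite big1 => [|k _]; last by rewrite eigval0 powR0 // gt_eqF.
by rewrite sumr_ge0 // => j _; rewrite sumr_ge0 // => k _; exact: powR_ge0.
Qed.

End Main.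

Theorem theorem3p1 (R : realType) (d m : nat) (hm : (2 <= m)%N)
    (A : 'I_m -> 'M[R[i]]_d) (hA : forall j, psdmx (A j))
    (p : R) (hp : 1 < p) :
  let C := spectral_sup A in
  let S := \sum_(j < m) A j in
  (schatten_norm p C = schatten_norm p S <->
     (forall i j : 'I_m, i != j -> A i *m A j = 0)) /\
  ((forall i j : 'I_m, i != j -> A i *m A j = 0) <-> C = S).
Proof.
move=> C S; have m0 : (0 < m)%N by exact: ltnW.
have p0 : 0 < p by exact: lt_trans ltr01 hp.
have orth_sup : (forall i j : 'I_m, i != j -> A i *m A j = 0) -> C = S.
  by move=> orthA; apply/spectral_supE/sum_ortho_is_sup.
have norm_orth : schatten_norm p C = schatten_norm p S ->
    forall i j : 'I_m, i != j -> A i *m A j = 0.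
  have [pC leC] := spectral_sup_spec m0 hA p0.
  have pS : psdmx S by exact: psd_sum.
  have sum_ge0 (X : 'M[R[i]]_d) : \sum_k eigval X k `^ p \is Num.nneg.
    by rewrite nnegrE sumr_ge0 // => k _; exact: powR_ge0.
  rewrite (schatten_norm_psd p pC) (schatten_norm_psd p pS).
  have ip0 : 0 < p^-1 by rewrite invr_gt0.
  move=> /(powR_injective ip0 (sum_ge0 C) (sum_ge0 S)) eqCS.
  apply: (mccarthy_eq hA hp); apply/eqP.
  by rewrite eq_le (mccarthy_le hA hp) -eqCS leC.
split; split; [exact: norm_orth|by move=> /orth_sup ->|exact: orth_sup|].
by move=> CS; apply: norm_orth; rewrite CS.
Qed.
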